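(* Let $d,M,D_\Phi\in\mathbb{N}_+$, let $\xi_1,\dots,\xi_M\in\mathbb{R}^d$ (memory patterns), $\delta\xi_1,\dots,\delta\xi_M\in\mathbb{R}^d$ (noises), let $\Phi:\mathbb{R}^d\to\mathbb{R}^{D_\Phi}$ be a feature map, and let $\epsilon'>0$, $\epsilon>0$, $C\ge 0$. Consider the support vector regression problem in the variables $W\in\mathbb{R}^{d\times D_\Phi}$ (with rows $w_1,\dots,w_d\in\mathbb{R}^{D_\Phi}$) and $\eta_\mu,\tilde\eta_\mu\in\mathbb{R}^d$, $\mu\in\{1,\dots,M\}$: $$\min_{W,\eta,\tilde\eta}\ \frac12\|W\|^2+C\sum_{\mu=1}^M\langle \mathbf 1,\eta_\mu+\tilde\eta_\mu\rangle$$ subject to, for all $\mu\in\{1,\dots,M\}$ (all inequalities component-wise), $$-(\epsilon'\mathbf 1+\tilde\eta_\mu)\le \xi_\mu-W\Phi(\xi_\mu+\delta\xi_\mu)\le \epsilon'\mathbf 1+\eta_\mu,\qquad \epsilon'\mathbf 1+\eta_\mu\le \frac{\epsilon}{\sqrt d}\mathbf 1,\qquad \eta_\mu\ge 0,\ \tilde\eta_\mu\ge 0 .$$ Let $W^\star=(w_1^\star,\dots,w_d^\star)^{\mathsf T}\in\mathbb{R}^{d\times D_\Phi}$ be the minimizer of this problem, and let $\alpha_\mu,\tilde\alpha_\mu\in\mathbb{R}^d$ ($\mu=1,\dots,M$) be the corresponding Lagrange multipliers (dual variables) of the upper constraints $\xi_\mu-W\Phi(\xi_\mu+\delta\xi_\mu)\le\epsilon'\mathbf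 1+\eta_\mu$ and of the lower constraints $-(\epsilon'\mathbf 1+\tilde\eta_\mu)\le\xi_\mu-W\Phi(\xi_\mu+\delta\xi_\mu)$, respectively. Then for every $i\in\{1,\dots,d\}$, $$w_i^\star=\sum_{\mu=1}^M\big(\alpha_\mu[i]-\tilde\alpha_\mu[i]\big)\,\Phi(\xi_\mu+\delta\xi_\mu).$$
   Context: $\mathbf 1\in\mathbb{R}^d$ is the all-ones vector; $a[i]$ denotes the $i$-th component of a vector $a$. $\|W\|^2=\sum_{i=1}^d\|w_i\|^2$, where $w_i$ are the rows of $W$ and $\|w_i\|$ is the Euclidean norm. *)

(* Defs.v *)
From mathcomp Require Import all_boot all_order all_algebra.
From mathcomp Require Import all_classical all_reals ereal.

Set Implicit Arguments.
Unset Strict Implicit.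
Unset Printing Implicit Defensive.

Import Order.TTheory GRing.Theory Num.Theory.
Local Open Scope classical_set_scope.
Local Open Scope ring_scope.

Definition dot (R : realType) (n : nat) (u v : 'cV[R]_n) : R :=
  \sum_(i < n) u i 0 * v i 0.

(* The norm that MathComp-Analysis puts on matrices is the sup norm, hence
   this explicit Euclidean one. *)
Definition enorm (R : realType) (n : nat) (u : 'cV[R]_n) : R :=
  Num.sqrt (dot u u).

Definition ones (R : realType) (n : nat) : 'cV[R]_n := const_mx 1.
Arguments ones {R n}.

Definition cvle (R : realType) (n : nat) (u v : 'cV[R]_n) : Prop :=
  forall i : 'I_n, u i 0 <= v i 0.

Definition wrow (R : realType) (d D : nat) (W : 'M[R]_(d, D)) (i : 'I_d) :
  'cV[R]_D := (row i W)^T.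

Record svr_var (R : realType) (d M D : nat) : Type := SvrVar {
  weight : 'M[R]_(d, D);
  eta : 'I_M -> 'cV[R]_d;
  eta' : 'I_M -> 'cV[R]_d
}.

Definition svr_objective (R : realType) (d M D : nat) (C : R)
    (x : svr_var R d M D) : R :=
  2^-1 * (\sum_(i < d) enorm (wrow (weight x) i) ^+ 2)
  + C * \sum_(mu < M) dot ones (eta x mu + eta' x mu).

Definition svr_residual (R : realType) (d M D : nat)
    (xi dxi : 'I_M -> 'cV[R]_d) (Phi : 'cV[R]_d -> 'cV[R]_D)
    (x : svr_var R d M D) (mu : 'I_M) : 'cV[R]_d :=
  xi mu - weight x *m Phi (xi mu + dxi mu).

Definition svr_feasible (R : realType) (d M D : nat)
    (xi dxi : 'I_M -> 'cV[R]_d) (Phi : 'cV[R]_d -> 'cV[R]_D)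
    (eps' eps : R) (x : svr_var R d M D) : Prop :=
  forall mu : 'I_M,
    [/\ cvle (svr_residual xi dxi Phi x mu) (eps' *: ones + eta x mu),
        cvle (- (eps' *: ones + eta' x mu)) (svr_residual xi dxi Phi x mu),
        cvle (eps' *: ones + eta x mu) ((eps / Num.sqrt d%:R) *: ones),
        cvle 0 (eta x mu)
      & cvle 0 (eta' x mu)].

Definition svr_minimizer (R : realType) (d M D : nat)
    (xi dxi : 'I_M -> 'cV[R]_d) (Phi : 'cV[R]_d -> 'cV[R]_D)
    (eps' eps C : R) (x : svr_var R d M D) : Prop :=
  svr_feasible xi dxi Phi eps' eps x
  /\ forall y : svr_var R d M D,
       svr_feasible xi dxi Phi eps' eps y ->
       svr_objective C x <= svr_objective C y.

(* One multiplier vector per vector constraint and per mu, in the order in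
   which the constraints are listed in svr_feasible. *)
Record svr_dual (R : realType) (d M : nat) : Type := SvrDual {
  alpha : 'I_M -> 'cV[R]_d;
  alpha' : 'I_M -> 'cV[R]_d;
  gamma : 'I_M -> 'cV[R]_d;
  beta : 'I_M -> 'cV[R]_d;
  beta' : 'I_M -> 'cV[R]_d
}.

Definition svr_dual_nonneg (R : realType) (d M : nat)
    (l : svr_dual R d M) : Prop :=
  forall mu : 'I_M,
    [/\ cvle 0 (alpha l mu), cvle 0 (alpha' l mu), cvle 0 (gamma l mu),
        cvle 0 (beta l mu) & cvle 0 (beta' l mu)].

Definition svr_lagrangian (R : realType) (d M D : nat)
    (xi dxi : 'I_M -> 'cV[R]_d) (Phi : 'cV[R]_d -> 'cV[R]_D)
    (eps' eps C : R) (x : svr_var R d M D) (l : svr_dual R d M) : R :=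
  svr_objective C x
  + \sum_(mu < M)
      (dot (alpha l mu)
         (svr_residual xi dxi Phi x mu - (eps' *: ones + eta x mu))
       + dot (alpha' l mu)
           (- (eps' *: ones + eta' x mu) - svr_residual xi dxi Phi x mu)
       + dot (gamma l mu)
           (eps' *: ones + eta x mu - (eps / Num.sqrt d%:R) *: ones)
       + dot (beta l mu) (- eta x mu)
       + dot (beta' l mu) (- eta' x mu)).

(* The infimum is over all primal variables, feasible or not, and may be
   -oo. *)
Definition svr_dual_function (R : realType) (d M D : nat)
    (xi dxi : 'I_M -> 'cV[R]_d) (Phi : 'cV[R]_d -> 'cV[R]_D)
    (eps' eps C : R) (l : svr_dual R d M) : \bar R :=
  ereal_inf [set (svr_lagrangian xi dxi Phi eps' eps C x l)%:E
            | x in [set: svr_var R d M D]].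

(* Optimal Lagrange multipliers are the solutions of the Lagrange dual
   problem. Neither zero duality gap nor stationarity of the Lagrangian at a
   primal minimizer is part of the definition. *)
Definition svr_lagrange_multipliers (R : realType) (d M D : nat)
    (xi dxi : 'I_M -> 'cV[R]_d) (Phi : 'cV[R]_d -> 'cV[R]_D)
    (eps' eps C : R) (l : svr_dual R d M) : Prop :=
  svr_dual_nonneg l
  /\ forall m : svr_dual R d M,
       svr_dual_nonneg m ->
       (svr_dual_function xi dxi Phi eps' eps C m
        <= svr_dual_function xi dxi Phi eps' eps C l)%E.

(* Main.v *)
(* The multipliers [l] solve the dual problem, which does not make them KKT
   multipliers by definition. Farkas' lemma provides KKT multipliers for [x]
   without any constraint qualification, since all constraints are affine, so
   the duality gap is zero and [x] minimises the Lagrangian at [l] over all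
   primal variables. As a function of the weights alone, that Lagrangian is
   [1/2 \sum_i |w_i - v_i|^2] plus a constant, where [v_i] is the claimed value
   of [w_i]; comparing [x] with the same point after each [w_i] is replaced by
   [v_i] forces [w_i = v_i]. *)
Require Import Defs.
From mathcomp Require Import all_boot all_order all_algebra.
From mathcomp Require Import all_classical all_reals ereal.
From mathcomp Require Import ring lra.

Set Implicit Arguments.
Unset Strict Implicit.
Unset Printing Implicit Defensive.

Import Order.TTheory GRing.Theory Num.Theory.
Local Open Scope ring_scope.

(** * Farkas' lemma and multipliers of convex quadratic programs *)

(** Purely algebraic induction on the list of constraints, valid in any dimension: a redundant
    constraint gets multiplier 0, any other is eliminated by projecting onto its kernel. [uniq r]
    keeps the value set at [k] from altering the multipliers of the tail. *)
Lemma farkas (R : realFieldType) (V : lmodType R) (I : eqType) (r : seq I)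
    (a : I -> V -> R) (b : V -> R) :
  uniq r -> (forall i, scalar (a i)) -> scalar b ->
  (forall v, (forall i, i \in r -> a i v <= 0) -> b v <= 0) ->
  exists2 lam : I -> R, (forall i, 0 <= lam i)
    & forall v, b v = \sum_(i <- r) lam i * a i v.
Proof.
elim: r a b => [|k r IHr] a b.
  move=> _ _ b_lin b_le0; exists (fun=> 0) => // v; rewrite big_nil.
  have b0 : b 0 = 0 by have := b_lin 1 0 0; rewrite scaler0 addr0 mul1r; lra.
  have {}b_le0 u : b u <= 0 by apply: b_le0.
  by have := b_le0 (-1 *: v + 0); rewrite b_lin b0; have := b_le0 v; lra.
move=> /= /andP[kNr r_uniq] a_lin b_lin b_le0.
have [imp|] := pselect (forall v, (forall i, i \in r -> a i v <= 0) -> b v <= 0).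
  have [lam lam_ge0 bE] := IHr a b r_uniq a_lin b_lin imp.
  exists (fun i => if i == k then 0 else lam i) => [i|v]; first by case: ifP.
  rewrite big_cons eqxx mul0r add0r bE; apply: eq_big_seq => i ir.
  by case: eqP => // ik; rewrite -ik ir in kNr.
move=> /existsNP[z0] /not_implyP[az0_le0] /negP; rewrite -ltNge => bz0_gt0.
have akz0_gt0 : 0 < a k z0.
  rewrite ltNge; apply/negP => akz0_le0; move: bz0_gt0; rewrite ltNge.
  by rewrite b_le0 // => i; rewrite inE => /orP[/eqP->//|/az0_le0].
(* [z0] is rescaled so that [a k z = 1]; the summand [+ 0] gives [z] the shape on which [scalar]
   rewrites. *)
pose z := (a k z0)^-1 *: z0 + 0.
have scale0 (f : V -> R) : scalar f -> f z = (a k z0)^-1 * f z0.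
  move=> f_lin; rewrite f_lin.
  by have := f_lin 1 0 0; rewrite scaler0 addr0 mul1r; lra.
have akz : a k z = 1 by rewrite scale0 // mulVf // gt_eqF.
have bz_gt0 : 0 < b z by rewrite scale0 // mulr_gt0 ?invr_gt0.
have az_le0 i : i \in r -> a i z <= 0.
  by move=> ir; rewrite scale0 // pmulr_rle0 ?invr_gt0 // az0_le0.
(* Composing with the projection [v - a k v *: z] onto the kernel of [a k]
   keeps the implication true without the k-th inequality. *)
have proj_lin (f : V -> R) :
    scalar f -> scalar (fun v => f (- a k v *: z + v)).
  by move=> f_lin c u v /=; rewrite !f_lin !a_lin; ring.
have [||v av_le0|lam lam_ge0 bE] :=
    IHr (fun i v => a i (- a k v *: z + v)) (fun v => b (- a k v *: z + v)) r_uniq.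
- by move=> i; apply: proj_lin.
- exact: proj_lin.
- apply: b_le0 => i; rewrite inE => /orP[/eqP->|/av_le0//].
  by rewrite a_lin akz; lra.
(* Expanding both sides of [bE v] by linearity leaves exactly this coefficient on [a k v]; it is
   nonnegative because [b z > 0] while [a i z <= 0] for [i] in [r]. *)
pose mu := b z - \sum_(i <- r) lam i * a i z.
exists (fun i => if i == k then mu else lam i) => [i|v].
  case: ifP => // _; rewrite subr_ge0 (le_trans _ (ltW bz_gt0)) //.
  rewrite big_seq sumr_le0 // => j /az_le0 azj.
  by rewrite mulr_ge0_le0.
rewrite big_cons eqxx.
rewrite (eq_big_seq (fun i => lam i * a i v)); last first.
  by move=> i ir /=; case: eqP => // ik; rewrite -ik ir in kNr.
have := bE v; rewrite b_lin /=.
under eq_bigr do rewrite a_lin mulrDr mulrCA.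
by rewrite big_split -mulr_sumr /= /mu; lra.
Qed.

(* The multipliers come from Farkas' lemma applied to the constraints
   homogenised by an extra variable [t], which is why no constraint
   qualification is needed. *)
Lemma convex_quadratic_multipliers (R : realFieldType) (V : lmodType R) (J : finType)
    (f q g : V -> R) (h a : J -> V -> R) (x : V) :
  scalar g -> (forall j, scalar (a j)) ->
  (forall v, 0 <= q v) -> (forall c v, q (c *: v) = c ^+ 2 * q v) ->
  (forall v, f (x + v) = f x + g v + q v) ->
  (forall j v, h j (x + v) = h j x + a j v) ->
  (forall j, h j x <= 0) ->
  (forall y, (forall j, h j y <= 0) -> f x <= f y) ->
  exists2 lam : J -> R, (forall j, 0 <= lam j)
    & forall y, f x <= f y + \sum_j lam j * h j y.
Proof.
move=> g_lin a_lin q_ge0 qZ fE hE hx_le0 fx_min.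
have lin0 (k : V -> R) : scalar k -> k 0 = 0.
  by move=> k_lin; have := k_lin 1 0 0; rewrite scaler0 addr0 mul1r; lra.
have linZ (k : V -> R) c v : scalar k -> k (c *: v) = c * k v.
  by move=> k_lin; rewrite -[c *: v]addr0 k_lin (lin0 k) // addr0.
have descent v : (forall j, h j x + a j v <= 0) -> 0 <= g v.
  move=> hv; rewrite leNgt; apply/negP => gv_lt0.
  have s_gt0 : 0 < q v - g v by have := q_ge0 v; lra.
  (* With this step length [g v + s * q v = s * g v], so the objective changes by
     [s ^+ 2 * g v < 0]; [s <= 1] keeps [x + s *: v] between the feasible points [x] and [x + v]. *)
  pose s := - g v / (q v - g v).
  have sE : s * (q v - g v) = - g v by rewrite /s mulfVK // gt_eqF.
  have s0 : 0 < s by rewrite divr_gt0 // oppr_gt0.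
  have s1 : s <= 1 by rewrite ler_pdivrMr // mul1r; have := q_ge0 v; lra.
  have /fx_min : forall j, h j (x + s *: v) <= 0.
    by move=> j; rewrite hE linZ //; have := hv j; have := hx_le0 j; nra.
  rewrite fE linZ // qZ.
  have -> : f x + s * g v + s ^+ 2 * q v = f x + s * (g v + s * q v) by ring.
  have : g v + s * q v = s * g v by lra.
  by move=> ->; rewrite lerDl !pmulr_rge0 // leNgt gv_lt0.
pose A (o : option J) (w : V * R^o) : R :=
  if o is Some j then a j w.1 + w.2 * h j x else - w.2.
have [||||lam lam_ge0 gE] := @farkas R (V * R^o)%type (option J)
    (None :: map Some (index_enum J)) A (fun w => - g w.1).
- rewrite /= map_inj_uniq ?index_enum_uniq ?andbT; last by move=> ? ? [].
  by apply/mapP => -[].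
- case=> [j|] c u v /=; last by rewrite /GRing.scale /=; ring.
  by rewrite a_lin /GRing.scale /=; ring.
- by move=> c u v /=; rewrite g_lin; ring.
- move=> [v t] /= Aw; rewrite oppr_le0.
  have Aj j : a j v + t * h j x <= 0.
    by apply: (Aw (Some j)); rewrite inE /= map_f // mem_index_enum.
  have : 0 <= t by rewrite -oppr_le0; apply: (Aw None); rewrite inE.
  (* For [t = 0], [v] is a recession direction and [x + v] is feasible; for [t > 0], [x + t^-1 *: v]
     is. Both cases fall under [descent]. *)
  rewrite le_eqVlt => /predU1P[t0|t_gt0].
    apply: descent => j; have := Aj j; rewrite -t0 mul0r addr0.
    by have := hx_le0 j; lra.
  have : 0 <= g (t^-1 *: v).
    apply: descent => j; rewrite linZ // -(pmulr_rle0 _ t_gt0) mulrDr mulVKf ?gt_eqF //.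
    by rewrite addrC.
  by rewrite linZ // pmulr_rge0 ?invr_gt0.
exists (fun j => lam (Some j)) => // y.
(* The Farkas identity at [(0, 1)] equates this sum with [lam None], which yields complementary
   slackness; below, at [(y - x, 0)], it yields stationarity. *)
have compl : 0 <= \sum_j lam (Some j) * h j x.
  have := gE (0, 1); rewrite big_cons big_map /= lin0 //.
  under eq_bigr do rewrite lin0 // add0r mul1r.
  by have := lam_ge0 None; lra.
have := gE (y - x, 0); rewrite big_cons big_map /= oppr0 mulr0 add0r.
under eq_bigr do rewrite mul0r addr0.
move=> gyx; have -> : y = x + (y - x) by rewrite addrC subrK.
rewrite fE; under eq_bigr do rewrite hE mulrDr.
by rewrite big_split /= -gyx; have := q_ge0 (y - x); lra.
Qed.

(** * The Euclidean inner product *)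

Lemma dot_ge0 (R : realType) (n : nat) (u : 'cV[R]_n) : 0 <= dot u u.
Proof. by apply: sumr_ge0 => i _; rewrite -expr2 sqr_ge0. Qed.

Lemma dot_eq0 (R : realType) (n : nat) (u : 'cV[R]_n) : (dot u u == 0) = (u == 0).
Proof.
apply/idP/eqP => [|->]; last by rewrite /dot big1 // => i _; rewrite mxE mul0r.
rewrite psumr_eq0 => [/allP u0|i _]; last by rewrite -expr2 sqr_ge0.
apply/colP => i; rewrite [RHS]mxE; apply/eqP; rewrite -sqrf_eq0 expr2.
exact: u0 (mem_index_enum i).
Qed.

Lemma enorm_sqr (R : realType) (n : nat) (u : 'cV[R]_n) : enorm u ^+ 2 = dot u u.
Proof. by rewrite sqr_sqrtr // dot_ge0. Qed.

(** * The regression problem as a family of scalar affine constraints *)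

Section SupportVectorRegression.
Variables (R : realType) (d M D : nat).
Variables (xi dxi : 'I_M -> 'cV[R]_d) (Phi : 'cV[R]_d -> 'cV[R]_D).
Variables (eps' eps C : R).

(** One index per scalar inequality: the constraint family, in the order of the fields of
    [svr_dual], then the pattern and the component. *)
Definition svr_index : finType := ('I_5 * ('I_M * 'I_d))%type.

Definition svr_gap (x : svr_var R d M D) (j : svr_index) : R :=
  let mu := j.2.1 in
  (nth 0 [:: svr_residual xi dxi Phi x mu - (eps' *: ones + eta x mu);
             - (eps' *: ones + eta' x mu) - svr_residual xi dxi Phi x mu;
             eps' *: ones + eta x mu - (eps / Num.sqrt d%:R) *: ones;
             - eta x mu; - eta' x mu] j.1 : 'cV[R]_d) j.2.2 0.

Definition svr_mult (l : svr_dual R d M) (j : svr_index) : R :=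
  let mu := j.2.1 in
  (nth 0 [:: alpha l mu; alpha' l mu; gamma l mu; beta l mu; beta' l mu] j.1
     : 'cV[R]_d) j.2.2 0.

Definition svr_dual_of (lam : svr_index -> R) : svr_dual R d M :=
  let col k mu := \col_i lam (inord k, (mu, i)) in
  SvrDual (col 0) (col 1) (col 2) (col 3) (col 4).

Lemma svr_dual_ofK lam j : svr_mult (svr_dual_of lam) j = lam j.
Proof.
case: j => k [mu i]; rewrite /svr_mult /= -[k in RHS]inord_val.
by case: k => -[|[|[|[|[|//]]]]] lt5 /=; rewrite mxE.
Qed.

Lemma svr_dual_nonnegP l : svr_dual_nonneg l <-> forall j, 0 <= svr_mult l j.
Proof.
split=> [l_ge0 [k [mu i]]|l_ge0 mu].
  have [l0 l1 l2 l3 l4] := l_ge0 mu.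
  have cv0 (u : 'cV[R]_d) : cvle 0 u -> 0 <= u i 0 by move=> /(_ i); rewrite mxE.
  by case: k => -[|[|[|[|[|//]]]]] lt5; apply: cv0.
by split=> i; rewrite mxE;
  [have := l_ge0 (inord 0, (mu, i)) | have := l_ge0 (inord 1, (mu, i))
  | have := l_ge0 (inord 2, (mu, i)) | have := l_ge0 (inord 3, (mu, i))
  | have := l_ge0 (inord 4, (mu, i))]; rewrite /svr_mult /= inordK.
Qed.

Lemma svr_feasibleP x :
  svr_feasible xi dxi Phi eps' eps x <-> forall j, svr_gap x j <= 0.
Proof.
split=> [fx [k [mu i]]|gap_le0 mu].
  have [c0 c1 c2 c3 c4] := fx mu.
  have := c0 i; have := c1 i; have := c2 i; have := c3 i; have := c4 i.
  by case: k => -[|[|[|[|[|//]]]]] lt5; rewrite /svr_gap /= !mxE; lra.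
have gap k i : (k < 5)%N -> svr_gap x (inord k, (mu, i)) <= 0 by [].
split=> i; [have := @gap 0%N i isT | have := @gap 1%N i isT
  | have := @gap 2%N i isT | have := @gap 3%N i isT | have := @gap 4%N i isT];
  by rewrite /svr_gap /= inordK //= !mxE; lra.
Qed.

Lemma svr_lagrangianE x l :
  svr_lagrangian xi dxi Phi eps' eps C x l
  = svr_objective C x + \sum_j svr_mult l j * svr_gap x j.
Proof.
congr (_ + _).
rewrite -(pair_bigA _ (fun k p => svr_mult l (k, p) * svr_gap x (k, p))) /=.
under [RHS]eq_bigr do
  rewrite -(pair_bigA _ (fun mu i => svr_mult l (_, (mu, i)) * svr_gap x (_, (mu, i)))) /=.
by rewrite !big_ord_recl big_ord0 addr0 -!big_split; apply: eq_bigr => mu _;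
  rewrite /= !addrA.
Qed.

(** * Lagrange duality *)

(** The objective at a displaced point is its value at [x] plus a linear and a nonnegative quadratic
    term, and each [svr_gap] is affine, so [convex_quadratic_multipliers] applies. *)
Lemma svr_strong_duality x : svr_minimizer xi dxi Phi eps' eps C x ->
  exists2 l, svr_dual_nonneg l
    & forall y, svr_objective C x <= svr_lagrangian xi dxi Phi eps' eps C y l.
Proof.
case=> /svr_feasibleP x_feas x_min.
(* The record of variables is traded for a product, which carries a module structure. *)
pose V := ('M[R]_(d, D) * ('I_M -> 'cV[R]_d) * ('I_M -> 'cV[R]_d))%type.
pose var (v : V) := SvrVar v.1.1 v.1.2 v.2.
(* The linear part of [svr_gap], family by family. *)
pose A (v : V) (j : svr_index) : R :=
  let mu := j.2.1 in let Wphi := v.1.1 *m Phi (xi mu + dxi mu) in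
  (nth 0 [:: - Wphi - v.1.2 mu; - v.2 mu + Wphi; v.1.2 mu; - v.1.2 mu; - v.2 mu] j.1
    : 'cV[R]_d) j.2.2 0.
have varK y : y = var (weight y, eta y, eta' y) by case: y.
pose q (v : V) : R := 2^-1 * \sum_i dot (wrow v.1.1 i) (wrow v.1.1 i).
pose g (v : V) : R := \sum_i dot (wrow (weight x) i) (wrow v.1.1 i)
  + C * \sum_mu dot ones (v.1.2 mu + v.2 mu).
have [||||||||lam lam_ge0 lamP] :=
  @convex_quadratic_multipliers R V svr_index (svr_objective C \o var) q g
    (fun j v => svr_gap (var v) j) (fun j v => A v j)
    (weight x, eta x, eta' x).
- move=> c u v; rewrite /g.
  suff [-> ->] :
    \sum_i dot (wrow (weight x) i) (wrow (c *: u + v).1.1 i)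
    = c * (\sum_i dot (wrow (weight x) i) (wrow u.1.1 i))
      + \sum_i dot (wrow (weight x) i) (wrow v.1.1 i)
    /\ \sum_mu dot ones ((c *: u + v).1.2 mu + (c *: u + v).2 mu)
    = c * (\sum_mu dot ones (u.1.2 mu + u.2 mu))
      + \sum_mu dot ones (v.1.2 mu + v.2 mu).
    by ring.
  rewrite !mulr_sumr -!big_split; split; apply: eq_bigr => k _ /=;
    rewrite /dot mulr_sumr -!big_split /=;
    by apply: eq_bigr => i _; rewrite !mxE; ring.
- case=> k [mu i] c u v; rewrite /A /= mulmxDl -scalemxAl.
  set wu := u.1.1 *m _; set wv := v.1.1 *m _.
  by case: k => -[|[|[|[|[|//]]]]] lt5 /=; rewrite !mxE; ring.
- by move=> v; rewrite mulr_ge0 ?invr_ge0 // sumr_ge0 // => i _; rewrite dot_ge0.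
- move=> c v; rewrite /q mulrCA; congr (_ * _); rewrite mulr_sumr.
  apply: eq_bigr => i _; rewrite /dot mulr_sumr; apply: eq_bigr => k _.
  by rewrite !mxE; ring.
- move=> v; rewrite /svr_objective /= !(eq_bigr _ (fun i _ => enorm_sqr _)) /g /q.
  rewrite [X in _ = _ + X + _]addrC.
  suff [-> ->] :
    \sum_i dot (wrow (weight x + v.1.1) i) (wrow (weight x + v.1.1) i)
    = \sum_i dot (wrow (weight x) i) (wrow (weight x) i)
      + 2 * (\sum_i dot (wrow (weight x) i) (wrow v.1.1 i))
      + \sum_i dot (wrow v.1.1 i) (wrow v.1.1 i)
    /\ \sum_mu dot ones (eta x mu + v.1.2 mu + (eta' x mu + v.2 mu))
    = \sum_mu dot ones (eta x mu + eta' x mu) + \sum_mu dot ones (v.1.2 mu + v.2 mu).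
    by field.
  rewrite mulr_sumr -!big_split /=; split; apply: eq_bigr => k _.
    rewrite /dot mulr_sumr -!big_split /=.
    by apply: eq_bigr => i _; rewrite !mxE; ring.
  by rewrite /dot -!big_split /=; apply: eq_bigr => i _; rewrite !mxE; ring.
- case=> k [mu i] v; rewrite /A /svr_gap /svr_residual /= mulmxDl.
  set wx := weight x *m _; set wv := v.1.1 *m _.
  by case: k => -[|[|[|[|[|//]]]]] lt5 /=; rewrite !mxE; ring.
- by move=> j; apply: x_feas.
- by move=> v /svr_feasibleP/x_min.
exists (svr_dual_of lam) => [|y].
  by apply/svr_dual_nonnegP => j; rewrite svr_dual_ofK.
rewrite svr_lagrangianE; under eq_bigr do rewrite svr_dual_ofK.
by have := lamP (weight y, eta y, eta' y); rewrite /= -varK.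
Qed.


Lemma svr_weak_duality x l :
  svr_feasible xi dxi Phi eps' eps x -> svr_dual_nonneg l ->
  svr_lagrangian xi dxi Phi eps' eps C x l <= svr_objective C x.
Proof.
move=> /svr_feasibleP x_feas /svr_dual_nonnegP l_ge0.
by rewrite svr_lagrangianE gerDl sumr_le0 // => j _; rewrite mulr_ge0_le0.
Qed.

(** With [m] the multipliers from strong duality, a chain closes: the Lagrangian at [(x, l)] is at
    most the objective at [x], then the dual value at [m], then that at [l] by dual optimality, then
    the Lagrangian at [(y, l)]. *)
Lemma svr_multipliers_saddle x l y :
  svr_minimizer xi dxi Phi eps' eps C x ->
  svr_lagrange_multipliers xi dxi Phi eps' eps C l ->
  svr_lagrangian xi dxi Phi eps' eps C x l
  <= svr_lagrangian xi dxi Phi eps' eps C y l.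
Proof.
move=> x_min [l_ge0 l_max].
apply: (le_trans (svr_weak_duality x_min.1 l_ge0)).
have [m m_ge0 mP] := svr_strong_duality x_min.
rewrite -lee_fin; apply: le_trans (_ : svr_dual_function xi dxi Phi eps' eps C l <= _)%E.
  apply: le_trans (l_max m m_ge0).
  by apply/ereal_infP => _ [z _ <-]; rewrite lee_fin.
by apply: ereal_inf_lbound; exists y.
Qed.

(** * Completing the square in the weights *)

Lemma svr_lagrangian_complete_square x l (W : 'M[R]_(d, D)) :
  (forall i, wrow W i
     = \sum_mu (alpha l mu i 0 - alpha' l mu i 0) *: Phi (xi mu + dxi mu)) ->
  svr_lagrangian xi dxi Phi eps' eps C x l
  = svr_lagrangian xi dxi Phi eps' eps C (SvrVar W (eta x) (eta' x)) l
    + 2^-1 * \sum_i enorm (wrow (weight x) i - wrow W i) ^+ 2.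
Proof.
move=> WE.
(* The Lagrangian is linear in the weights through the residuals alone, where they enter as [- pen];
   summing over patterns first turns [pen] into inner products with the rows of [W]. *)
pose pen (V : 'M[R]_(d, D)) := \sum_mu \sum_i
  (alpha l mu i 0 - alpha' l mu i 0) * (V *m Phi (xi mu + dxi mu)) i 0.
have penE V : pen V = \sum_i dot (wrow V i) (wrow W i).
  rewrite /pen exchange_big; apply: eq_bigr => i _ /=; rewrite WE /dot.
  under [RHS]eq_bigr do rewrite summxE mulr_sumr.
  rewrite exchange_big; apply: eq_bigr => mu _ /=.
  by rewrite mxE mulr_sumr; apply: eq_bigr => k _; rewrite !mxE; ring.
(* Weights 0 serve as the reference point that collects all terms free of [V]. *)
have lagE V e e' :
    svr_lagrangian xi dxi Phi eps' eps C (SvrVar V e e') l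
    = 2^-1 * (\sum_i dot (wrow V i) (wrow V i)) - pen V
      + svr_lagrangian xi dxi Phi eps' eps C (SvrVar 0 e e') l.
  rewrite /svr_lagrangian /svr_objective /= !(eq_bigr _ (fun i _ => enorm_sqr _)).
  rewrite [\sum_i dot (wrow 0 i) _]big1 => [|i _]; last first.
    by rewrite /dot big1 // => k _; rewrite !mxE mul0r.
  rewrite mulr0 add0r -!addrA; congr (_ + _); rewrite addrCA; congr (_ + _).
  rewrite /pen -sumrN -big_split; apply: eq_bigr => mu _ /=.
  rewrite /svr_residual /= mul0mx !addrA; do 3!congr (_ + _).
  rewrite /dot -sumrN -!big_split /=; apply: eq_bigr => i _.
  by set v := V *m _; rewrite !mxE; ring.
have -> : x = SvrVar (weight x) (eta x) (eta' x) by case: x.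
rewrite lagE [in RHS]lagE !penE (eq_bigr _ (fun i _ => enorm_sqr _)) /=.
have -> : \sum_i dot (wrow (weight x) i - wrow W i) (wrow (weight x) i - wrow W i)
    = \sum_i dot (wrow (weight x) i) (wrow (weight x) i)
      - 2 * (\sum_i dot (wrow (weight x) i) (wrow W i))
      + \sum_i dot (wrow W i) (wrow W i).
  rewrite mulr_sumr -sumrN -!big_split /=; apply: eq_bigr => i _.
  rewrite /dot mulr_sumr -sumrN -!big_split /=; apply: eq_bigr => k _.
  by rewrite !mxE; ring.
by field.
Qed.

End SupportVectorRegression.

Theorem theorem3p1 (R : realType) (d M D : nat)
    (hd : (0 < d)%N) (hM : (0 < M)%N) (hD : (0 < D)%N)
    (xi dxi : 'I_M -> 'cV[R]_d) (Phi : 'cV[R]_d -> 'cV[R]_D)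
    (eps' eps C : R) (heps' : 0 < eps') (heps : 0 < eps) (hC : 0 <= C)
    (x : svr_var R d M D)
    (hx : svr_minimizer xi dxi Phi eps' eps C x)
    (l : svr_dual R d M)
    (hl : svr_lagrange_multipliers xi dxi Phi eps' eps C l) :
  forall i : 'I_d,
    wrow (weight x) i
    = \sum_(mu < M) (alpha l mu i 0 - alpha' l mu i 0) *: Phi (xi mu + dxi mu).
Proof.
pose w i := \sum_mu (alpha l mu i 0 - alpha' l mu i 0) *: Phi (xi mu + dxi mu).
pose W := \matrix_i (w i)^T.
have WE i : wrow W i = w i by rewrite /wrow rowK trmxK.
have := svr_multipliers_saddle (SvrVar W (eta x) (eta' x)) hx hl.
(* Both Lagrangians share their slack variables, so only the sum of squares survives, and it must be
   nonpositive. *)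
rewrite (svr_lagrangian_complete_square _ _ _ x WE) gerDl pmulr_rle0 ?invr_gt0 //.
move=> sum_le0 i.
have /eqP : \sum_i enorm (wrow (weight x) i - wrow W i) ^+ 2 = 0.
  by apply/eqP; rewrite eq_le sum_le0 sumr_ge0 // => j _; apply: sqr_ge0.
rewrite psumr_eq0 => [/allP/(_ i (mem_index_enum i))|j _]; last exact: sqr_ge0.
rewrite /= enorm_sqr dot_eq0 subr_eq0 -/(w i) -WE.
exact: eqP.
Qed.
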